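(* Let $m>1$ be an integer, let $p_i$ ($i\in\mathbb{Z}/(m)$) be pairwise distinct prime numbers, and let $n_i,s_i$ ($i\in\mathbb{Z}/(m)$) be positive integers. Then the left brace $T\rtimes_\circ S$ constructed from these data in the context is simple.
   Context: A left brace is a set $B$ with two binary operations $+$ and $\cdot$ such that $(B,+)$ is an abelian group, $(B,\cdot)$ is a group, and $a\cdot(b+c)+a=a\cdot b+a\cdot c$ for all $a,b,c\in B$. For $a,b\in B$ put $\lambda_a(b)=a\cdot b-a$. An ideal of $B$ is a normal subgroup $I$ of $(B,\cdot)$ such that $\lambda_a(b)\in I$ for all $b\in I$ and $a\in B$. A left brace $B$ is simple if $B\neq\{0\}$ and $\{0\}$ and $B$ are the only ideals of $B$. Construction. Let $m>1$; indices are taken in $\mathbb{Z}/(m)$ and represented by $1,\dots,m$. For each $i$ let $p_i$ be a prime, with $p_i\ne p_j$ for $i\neq j$, and let $n_i,s_i$ be positive integers. Let $R_i=\mathbb{Z}/(p_i^{n_i})$ and $$q_i(x)=\sum_{k=0}^{p_i-1}x^{kp_i^{n_i-1}}\in R_{i+1}[x],\qquad l_i=\deg q_i(x)=p_i^{n_i}-p_i^{n_i-1}.$$ Let $C_i\in M_{l_{i-1}}(R_i)$ be the companion matrix of $q_{i-1}(x)\in R_i[x]$; it is invertible of order $p_{i-1}^{n_{i-1}}$. Let $T_i=R_i^{2l_{i-1}}$ (row vectors), and define the symmetric bilinear form $b_i\colon T_i\times T_i\to R_i$ and the automorphism $f_i\in\operatorname{Aut}(T_i)$ by $$b_i(u,v)=u\begin{pmatrix}0&I_{l_{i-1}}\\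 I_{l_{i-1}}&0\end{pmatrix}v^t,\qquad f_i(u)=u\begin{pmatrix}C_i^t&0\\ 0&C_i^{-1}\end{pmatrix}.$$ Then $f_i$ preserves $b_i$ and has order $p_{i-1}^{n_{i-1}}$, so $f_i^{a}$ makes sense for $a\in R_{i-1}$. Let $T=T_1^{s_1}\times\cdots\times T_m^{s_m}$ and $S=R_1\times\cdots\times R_m$ (additive groups). Write elements of $T$ as $u=(u_{i,j})$ with $u_{i,j}\in T_i$, $1\le i\le m$, $1\le j\le s_i$. Define the symmetric bi-additive map $b\colon T\times T\to S$ by $$b\bigl((u_{i,j}),(v_{i,j})\bigr)=\Bigl(\sum_{j=1}^{s_1}b_1(u_{1,j},v_{1,j}),\dots,\sum_{j=1}^{s_m}b_m(u_{m,j},v_{m,j})\Bigr),$$ and the homomorphism $\alpha\colon (S,+)\to\operatorname{Aut}(T)$, $a\mapsto\alpha_a$, by: for $a=(a_1,\dots,a_m)\in S$, the $(i,j)$ component of $\alpha_a(u)$ is $f_i^{a_{i-1}}(u_{i,j})$ (with $a_0=a_m$). The left brace $T\rtimes_\circ S$ (the asymmetric product of the trivial braces $T$ and $S$ via $b$ and $\alpha$) is the set $T\times S$ with operations $$(t_1,c_1)+(t_2,c_2)=(t_1+t_2,\;c_1+c_2+b(t_1,t_2)),\qquad (t_1,c_1)\cdot(t_2,c_2)=(t_1+\alpha_{c_1}(t_2),\;c_1+c_2).$$ *)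

(* Defs.v *)
From HB Require Import structures.
From mathcomp Require Import all_boot all_order all_algebra.

Set Implicit Arguments.
Unset Strict Implicit.
Unset Printing Implicit Defensive.

Import GRing.Theory.
Local Open Scope ring_scope.

(* The multiplicative group law is MathComp's [groupType] law, in scope %g. *)
HB.mixin Record Zmodule_Group_isLeftBrace B of GRing.Zmodule B & Group B := {
  braceDr : forall a b c : B,
    (a * (b + c)%R)%g + a = (a * b)%g + (a * c)%g
}.

#[short(type="leftBraceType")]
HB.structure Definition LeftBrace :=
  {B of Zmodule_Group_isLeftBrace B & GRing.Zmodule B & Group B}.

Definition brace_lambda (B : leftBraceType) (a b : B) : B := (a * b)%g - a.

Record is_ideal (B : leftBraceType) (I : B -> Prop) : Prop := IsIdeal {
  ideal1 : I 1%g;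
  idealM : forall a b : B, I a -> I b -> I (a * b)%g;
  idealV : forall a : B, I a -> I (a^-1)%g;
  idealJ : forall a b : B, I b -> I (a * b * a^-1)%g;
  ideal_lambda : forall a b : B, I b -> I (brace_lambda a b)
}.

Definition simple_brace (B : leftBraceType) : Prop :=
  (exists x : B, x <> 0) /\
  (forall I : B -> Prop, is_ideal I ->
     (forall x : B, I x <-> x = 0) \/ (forall x : B, I x)).

(* Data for an asymmetric product of two trivial braces.  [asym_act] is a      *)
(* homomorphism from S to Aut(T): bijectivity of each [asym_act c] follows     *)
(* from [asym_act0] and [asym_actD].                                           *)
Record asym_data (T S : zmodType) : Type := AsymData {
  asym_form : T -> T -> S;
  asym_act : S -> T -> T;
  asym_formC : forall u v : T, asym_form u v = asym_form v u;
  asym_formDl : forall u v w : T,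
    asym_form (u + v) w = asym_form u w + asym_form v w;
  asym_act_morph : forall (c : S) (u v : T),
    asym_act c (u + v) = asym_act c u + asym_act c v;
  asym_act0 : forall u : T, asym_act 0 u = u;
  asym_actD : forall (c d : S) (u : T),
    asym_act (c + d) u = asym_act c (asym_act d u);
  asym_act_form : forall (c : S) (u v : T),
    asym_form (asym_act c u) (asym_act c v) = asym_form u v
}.

(* A wrapper around T * S, so that the componentwise addition of pairs does    *)
(* not interfere with the brace addition.                                      *)
Record asym_prod (T S : zmodType) (D : asym_data T S) : Type :=
  AsymProd { asym_fst : T; asym_snd : S }.

Section AsymmetricProduct.

Context (T S : zmodType) (D : asym_data T S).

Local Notation P := (asym_prod D).
Local Notation b := (asym_form D).
Local Notation alpha := (asym_act D).

Definition asym_to_pair (x : P) : T * S := (asym_fst x, asym_snd x).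
Definition asym_of_pair (x : T * S) : P := AsymProd D x.1 x.2.

Lemma asym_to_pairK : cancel asym_to_pair asym_of_pair.
Proof. by case. Qed.

HB.instance Definition _ := Choice.copy P (can_type asym_to_pairK).

Definition asym_add (x y : P) : P :=
  AsymProd D (asym_fst x + asym_fst y)
    (asym_snd x + asym_snd y + b (asym_fst x) (asym_fst y)).

Definition asym_mul (x y : P) : P :=
  AsymProd D (asym_fst x + alpha (asym_snd x) (asym_fst y))
    (asym_snd x + asym_snd y).

Definition asym_opp (x : P) : P :=
  AsymProd D (- asym_fst x) (- asym_snd x + b (asym_fst x) (asym_fst x)).

Definition asym_inv (x : P) : P :=
  AsymProd D (- alpha (- asym_snd x) (asym_fst x)) (- asym_snd x).

Lemma asym_formDr u v w : b u (v + w) = b u v + b u w.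
Proof. by rewrite !(asym_formC _ u) asym_formDl. Qed.

Lemma asym_form0l u : b 0 u = 0.
Proof. by apply: (addrI (b 0 u)); rewrite -asym_formDl !addr0. Qed.

Lemma asym_formNl u v : b (- u) v = - b u v.
Proof. by apply: (addrI (b u v)); rewrite -asym_formDl !subrr asym_form0l. Qed.

Lemma asym_actu0 c : alpha c 0 = 0.
Proof. by apply: (addrI (alpha c 0)); rewrite -asym_act_morph !addr0. Qed.

Lemma asym_actN c u : alpha c (- u) = - alpha c u.
Proof.
by apply: (addrI (alpha c u)); rewrite -asym_act_morph !subrr asym_actu0.
Qed.

Fact asym_addA : associative asym_add.
Proof.
case=> [t c] [t' c'] [t'' c'']; rewrite /asym_add /=.
congr AsymProd; first exact: addrA.
by rewrite asym_formDl asym_formDr !addrA [LHS](ACl (1*2*5*3*6*4)).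
Qed.

Fact asym_addC : commutative asym_add.
Proof.
case=> [t c] [t' c']; rewrite /asym_add /= addrC; congr AsymProd.
by rewrite (addrC c) asym_formC.
Qed.

Fact asym_add0 : left_id (AsymProd D 0 0) asym_add.
Proof.
by case=> [t c]; rewrite /asym_add /= add0r asym_form0l addr0 add0r.
Qed.

Fact asym_addN : left_inverse (AsymProd D 0 0) asym_opp asym_add.
Proof.
case=> [t c]; rewrite /asym_add /= addNr asym_formNl; congr AsymProd.
by rewrite [_ + _ + c]addrAC addrK addNr.
Qed.

HB.instance Definition _ :=
  GRing.isZmodule.Build P asym_addA asym_addC asym_add0 asym_addN.

Fact asym_mulA : associative asym_mul.
Proof.
case=> [t c] [t' c'] [t'' c'']; rewrite /asym_mul /= !addrA; congr AsymProd.
by rewrite asym_act_morph asym_actD addrA.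
Qed.

Fact asym_mul1 : left_id (AsymProd D 0 0) asym_mul.
Proof. by case=> [t c]; rewrite /asym_mul /= asym_act0 !add0r. Qed.

Fact asym_mulr1 : right_id (AsymProd D 0 0) asym_mul.
Proof. by case=> [t c]; rewrite /asym_mul /= asym_actu0 !addr0. Qed.

Fact asym_mulV : left_inverse (AsymProd D 0 0) asym_inv asym_mul.
Proof. by case=> [t c]; rewrite /asym_mul /= !addNr. Qed.

Fact asym_mulrV : right_inverse (AsymProd D 0 0) asym_inv asym_mul.
Proof.
case=> [t c]; rewrite /asym_mul /= asym_actN -asym_actD !subrr.
by rewrite asym_act0 subrr.
Qed.

HB.instance Definition _ := isGroup.Build P
  asym_mulA asym_mul1 asym_mulr1 asym_mulV asym_mulrV.

Fact asym_braceDr (x y z : P) :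
  (x * (y + z)%R)%g + x = (x * y)%g + (x * z)%g.
Proof.
case: x y z => [t c] [t' c'] [t'' c''].
rewrite -[LHS]/(asym_add (asym_mul _ (asym_add _ _)) _).
rewrite -[RHS]/(asym_add (asym_mul _ _) (asym_mul _ _)).
rewrite /asym_add /asym_mul /=; congr AsymProd.
  by rewrite asym_act_morph !addrA [LHS](ACl (1*2*4*3)).
rewrite asym_act_morph !(asym_formDl, asym_formDr) asym_act_form.
rewrite ![b (alpha _ _) t]asym_formC !addrA.
by rewrite [LHS](ACl (1*2*5*3*6*8*7*4)).
Qed.

HB.instance Definition _ := Zmodule_Group_isLeftBrace.Build P asym_braceDr.

Lemma asym_prod_addE (t1 t2 : T) (c1 c2 : S) :
  (AsymProd D t1 c1 + AsymProd D t2 c2)%R =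
  AsymProd D (t1 + t2) (c1 + c2 + b t1 t2).
Proof. by []. Qed.

Lemma asym_prod_mulE (t1 t2 : T) (c1 c2 : S) :
  (AsymProd D t1 c1 * AsymProd D t2 c2)%g =
  AsymProd D (t1 + alpha c1 t2) (c1 + c2).
Proof. by []. Qed.

End AsymmetricProduct.

Section DependentFfun.

Context (I : finType) (V : I -> zmodType).

Local Notation U := {dffun forall i : I, V i}.

Definition dffun_zero : U := [ffun i => 0].
Definition dffun_opp (x : U) : U := [ffun i => - x i].
Definition dffun_add (x y : U) : U := [ffun i => x i + y i].

Fact dffun_addA : associative dffun_add.
Proof. by move=> x y z; apply/ffunP=> i; rewrite !ffunE addrA. Qed.

Fact dffun_addC : commutative dffun_add.
Proof. by move=> x y; apply/ffunP=> i; rewrite !ffunE addrC. Qed.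

Fact dffun_add0 : left_id dffun_zero dffun_add.
Proof. by move=> x; apply/ffunP=> i; rewrite !ffunE add0r. Qed.

Fact dffun_addN : left_inverse dffun_zero dffun_opp dffun_add.
Proof. by move=> x; apply/ffunP=> i; rewrite !ffunE addNr. Qed.

HB.instance Definition _ := GRing.isZmodule.Build U
  dffun_addA dffun_addC dffun_add0 dffun_addN.

End DependentFfun.

Section QPoly.

Context (R : comNzRingType) (p n : nat).

Definition q_poly : {poly R} := \sum_(k < p) 'X^(k * p ^ n.-1).

Hypotheses (hp : prime p) (hn : (0 < n)%N).

Lemma mul_q_poly : ('X^(p ^ n.-1) - 1) * q_poly = 'X^(p ^ n) - 1.
Proof.
rewrite /q_poly -[in RHS](prednK hn) expnSr exprM [RHS]subrX1; congr (_ * _).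
by apply: eq_bigr => k _; rewrite mulnC exprM.
Qed.

Lemma q_poly_monic : q_poly \is monic.
Proof.
have h k : 'X^(p ^ k) - 1 \is @monic R.
  by rewrite -polyC1 monicXnsubC// expn_gt0 prime_gt0.
by rewrite -(monicMl _ (h n.-1)) mul_q_poly.
Qed.

Lemma size_q_poly : size q_poly = (p ^ n - p ^ n.-1).+1.
Proof.
have h k : size ('X^(p ^ k) - 1 : {poly R}) = (p ^ k).+1.
  by rewrite -polyC1 size_XnsubC// expn_gt0 prime_gt0.
have hm : 'X^(p ^ n.-1) - 1 \is @monic R.
  by rewrite -polyC1 monicXnsubC// expn_gt0 prime_gt0.
have := size_monicM hm (monic_neq0 q_poly_monic).
rewrite mul_q_poly !h addSn /= => e.
by rewrite -subSn ?leq_exp2l ?prime_gt1 ?leq_pred// e addKn.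
Qed.

End QPoly.

Lemma expmx_char_dvd (R : comNzRingType) d (A : 'M[R]_d) (r : {poly R}) N :
  r * char_poly A = 'X^N - 1 -> A ^+ N = 1%:M.
Proof.
case: d A => [|d] A e; first by apply/matrixP=> -[].
have := congr1 (horner_mx A) e.
rewrite rmorphM /= Cayley_Hamilton mulr0 rmorphB rmorph1 rmorphXn /=.
by rewrite horner_mx_X => /esym/eqP; rewrite subr_eq0 => /eqP.
Qed.

Lemma expmx_tr (R : comNzRingType) d (A : 'M[R]_d) k :
  (A^T) ^+ k = (A ^+ k)^T.
Proof.
elim: k => [|k IHk]; first by rewrite !expr0 trmx1.
by rewrite exprSr IHk exprS -[LHS]/(_ *m _) -[A * _]/(_ *m _) trmx_mul.
Qed.

Lemma expmx_inv (R : comUnitRingType) d (A : 'M[R]_d) k :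
  A \in unitmx -> (invmx A ^+ k) *m (A ^+ k) = 1%:M.
Proof.
move=> uA; elim: k => [|k IHk]; first by rewrite !expr0 mulmx1.
rewrite exprSr exprS -[invmx A ^+ k * _]/(_ *m _) -[A * _]/(_ *m _).
by rewrite mulmxA -(mulmxA _ (invmx A)) mulVmx // mulmx1.
Qed.

Lemma expmx_block_diag (R : comNzRingType) d e (A : 'M[R]_d) (B : 'M[R]_e) k :
  (block_mx A 0 0 B) ^+ k = block_mx (A ^+ k) 0 0 (B ^+ k).
Proof.
elim: k => [|k IHk]; first by rewrite !expr0 -scalar_mx_block.
rewrite exprS IHk -[LHS]/(_ *m _) mulmx_block.
by rewrite !(mulmx0, mul0mx, addr0, add0r) !exprS.
Qed.

Section Construction.

Context (m : nat) (p n s : 'I_m -> nat).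

Local Notation R i := 'Z_(p i ^ n i).

(* q_{i-1}(x), with coefficients in R_i.  Indices are cyclic in 'I_m, so that  *)
(* i - 1 is [ord_pred i]; R_i = 'Z_(p_i ^ n_i) is Z/(p_i^n_i) only because     *)
(* p_i ^ n_i > 1, which holds for p_i prime and n_i > 0.                       *)
Definition q_prev (i : 'I_m) : {poly R i} :=
  q_poly (R i) (p (ord_pred i)) (n (ord_pred i)).

(* l_{i-1}, as the degree of q_{i-1}; see [l_prevE] for the closed form.       *)
Definition l_prev (i : 'I_m) : nat := (size (q_prev i)).-1.

Definition C_mx (i : 'I_m) : 'M[R i]_(l_prev i) := companionmx (q_prev i).

Definition T_ (i : 'I_m) : zmodType := 'rV[R i]_(l_prev i + l_prev i).

Definition J_mx (i : 'I_m) : 'M[R i]_(l_prev i + l_prev i) :=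
  block_mx 0 1%:M 1%:M 0.

Definition F_mx (i : 'I_m) : 'M[R i]_(l_prev i + l_prev i) :=
  block_mx (C_mx i)^T 0 0 (invmx (C_mx i)).

Definition b_ (i : 'I_m) (u v : T_ i) : R i := (u *m J_mx i *m v^T) 0 0.

Definition f_ (i : 'I_m) (u : T_ i) : T_ i := u *m F_mx i.

Definition T_prod : zmodType :=
  {dffun forall i : 'I_m, {ffun 'I_(s i) -> T_ i}}.

Definition S_prod : zmodType := {dffun forall i : 'I_m, R i}.

Definition b_prod (u v : T_prod) : S_prod :=
  [ffun i => \sum_(j < s i) b_ (u i j) (v i j)].

(* For c in R_{i-1}, f_i^c is iteration along the representative of c in nat;  *)
(* [iter_f_mod] shows that the choice of representative does not matter.       *)
Definition alpha_prod (a : S_prod) (u : T_prod) : T_prod :=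
  [ffun i => [ffun j => iter (a (ord_pred i)) (@f_ i) (u i j)]].

Hypotheses (hp : forall i, prime (p i)) (hn : forall i, (0 < n i)%N).

Lemma l_prevE i : l_prev i =
  (p (ord_pred i) ^ n (ord_pred i) - p (ord_pred i) ^ (n (ord_pred i)).-1)%N.
Proof. by rewrite /l_prev size_q_poly. Qed.

Lemma C_mx_order i : C_mx i ^+ (p (ord_pred i) ^ n (ord_pred i)) = 1%:M.
Proof.
apply: (@expmx_char_dvd _ _ _ ('X^(p (ord_pred i) ^ (n (ord_pred i)).-1) - 1)).
by rewrite companionmxK ?mul_q_poly// q_poly_monic.
Qed.

Lemma C_mx_unit i : C_mx i \in unitmx.
Proof.
have := C_mx_order i.
rewrite -(prednK (_ : 0 < p (ord_pred i) ^ n (ord_pred i))%N); last first.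
  by rewrite expn_gt0 prime_gt0.
by rewrite exprS => /mulmx1_unit[].
Qed.

Lemma F_mx_order i : F_mx i ^+ (p (ord_pred i) ^ n (ord_pred i)) = 1%:M.
Proof.
rewrite /F_mx expmx_block_diag expmx_tr.
have := expmx_inv (p (ord_pred i) ^ n (ord_pred i)) (C_mx_unit i).
by rewrite C_mx_order mulmx1 => ->; rewrite trmx1 -scalar_mx_block.
Qed.

Lemma F_mx_form i : F_mx i *m J_mx i *m (F_mx i)^T = J_mx i.
Proof.
have hC := C_mx_unit i.
rewrite /F_mx /J_mx tr_block_mx !mulmx_block trmxK !trmx0.
rewrite !(mulmx0, mul0mx, addr0, add0r, mulmx1, mulVmx hC) -trmx_mul.
by rewrite mulVmx // trmx1.
Qed.

Lemma iter_f_E i k (u : T_ i) : iter k (@f_ i) u = u *m F_mx i ^+ k.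
Proof.
elim: k => [|k IHk]; first by rewrite expr0 mulmx1.
by rewrite iterS IHk /f_ exprSr -[F_mx i ^+ k * _]/(_ *m _) [RHS]mulmxA.
Qed.

Lemma iter_f_mod i k (u : T_ i) :
  iter (k %% p (ord_pred i) ^ n (ord_pred i)) (@f_ i) u = iter k (@f_ i) u.
Proof.
rewrite !iter_f_E {2}(divn_eq k (p (ord_pred i) ^ n (ord_pred i))).
by rewrite exprD mulnC exprM F_mx_order expr1n mul1r.
Qed.

Lemma b_C i (u v : T_ i) : b_ u v = b_ v u.
Proof.
have JT : (J_mx i)^T = J_mx i by rewrite /J_mx tr_block_mx !trmx0 !trmx1.
have -> : b_ u v = (u *m J_mx i *m v^T)^T 0 0 by rewrite mxE.
by rewrite !trmx_mul trmxK JT mulmxA.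
Qed.

Lemma b_prodC u v : b_prod u v = b_prod v u.
Proof.
by apply/ffunP=> i; rewrite !ffunE; apply: eq_bigr => j _; rewrite b_C.
Qed.

Lemma b_prodDl u v w : b_prod (u + v) w = b_prod u w + b_prod v w.
Proof.
apply/ffunP=> i; rewrite !ffunE -big_split; apply: eq_bigr => j _.
by rewrite /b_ !ffunE !mulmxDl mxE.
Qed.

Lemma alpha_prod_morph a u v :
  alpha_prod a (u + v) = alpha_prod a u + alpha_prod a v.
Proof.
apply/ffunP=> i; rewrite !ffunE; apply/ffunP=> j; rewrite !ffunE !iter_f_E.
exact: mulmxDl.
Qed.

Lemma alpha_prod0 u : alpha_prod 0 u = u.
Proof. by apply/ffunP=> i; rewrite ffunE; apply/ffunP=> j; rewrite !ffunE. Qed.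

Lemma alpha_prodD a c u :
  alpha_prod (a + c) u = alpha_prod a (alpha_prod c u).
Proof.
apply/ffunP=> i; rewrite !ffunE; apply/ffunP=> j; rewrite !ffunE -iterD.
rewrite -[RHS]iter_f_mod; congr (iter (_ %% _) _ _).
by rewrite Zp_cast // -(expn0 (p (ord_pred i))) ltn_exp2l // prime_gt1.
Qed.

Lemma alpha_prod_form a u v :
  b_prod (alpha_prod a u) (alpha_prod a v) = b_prod u v.
Proof.
apply/ffunP=> i; rewrite !ffunE; apply: eq_bigr => j _; rewrite !ffunE.
elim: (nat_of_ord _) => //= k <-; rewrite /b_ /f_ trmx_mul.
by rewrite -[in RHS]F_mx_form !mulmxA.
Qed.

Definition TS_data : asym_data T_prod S_prod :=
  AsymData b_prodC b_prodDl alpha_prod_morph alpha_prod0 alpha_prodD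
    alpha_prod_form.

Definition TS_brace : leftBraceType := asym_prod TS_data.

End Construction.

(* Main.v *)
Require Import Defs.
From Stdlib Require Import Classical_Prop.
From HB Require Import structures.
From mathcomp Require Import all_boot all_order all_algebra.

Set Implicit Arguments.
Unset Strict Implicit.
Unset Printing Implicit Defensive.

(* If an ideal I contains (t, c), comparing (t, c) with its image under         *)
(* lambda_(-u, 0) puts (0, b(t, u)) in I; since b is nondegenerate, a nonzero   *)
(* ideal contains some (0, c) with c <> 0.  If (0, c) is in I, comparing it     *)
(* with its conjugates puts all (u - alpha_c(u), 0) in I.  Now 1 - f_i ^ k is   *)
(* invertible as soon as k <> 0 in R_(i-1), because q_(i-1)(1) = p_(i-1) is a   *)
(* unit of R_i.  Hence c_(i-1) <> 0 forces T_i^(s_i) x 0, and then 0 x R_i, to  *)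
(* lie in I, and this propagates around the cycle Z/(m).                        *)

Import GRing.Theory.
Local Open Scope ring_scope.

(** Inside an ideal the two components generate each other: b turns T-parts into S-parts
    ([asym_ideal_form]), and the action turns S-parts into T-parts ([asym_ideal_act]). As alpha
    shifts indices, a nonzero coordinate i-1 in S yields all of coordinate i in T, hence in S
    ([ideal_single]); going once round Z/(m) fills everything ([ideal_all_single], [ideal_full]).
    The arithmetic input is [expmxB1_unit], applied with p_(i-1) a unit modulo p_i^(n_i). *)

Section IdealTheory.

Context (B : leftBraceType) (I : B -> Prop) (idI : is_ideal I).

Lemma brace_mulr0 (a : B) : (a * 0%R)%g = a.
Proof. by have := braceDr a 0 0; rewrite addr0 => /addrI/esym. Qed.

Lemma brace_1E : 1%g = 0 :> B.
Proof. by rewrite -[LHS]brace_mulr0 mul1g. Qed.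

(** Ideals are defined multiplicatively; this identity makes them closed under addition, since they
    are stable under lambda. *)
Lemma brace_addE (a b : B) : a + b = (a * brace_lambda (a^-1)%g b)%g.
Proof.
have := braceDr a (brace_lambda (a^-1)%g b) a^-1%g.
by rewrite /brace_lambda subrK mulVKg mulgV brace_1E addr0 addrC.
Qed.

Lemma ideal_add (a b : B) : I a -> I b -> I (a + b).
Proof.
by move=> Ia Ib; rewrite brace_addE; apply: idealM => //; apply: ideal_lambda.
Qed.

Lemma ideal_opp (a : B) : I a -> I (- a).
Proof.
(* lambda_a(a^-1) = 1 - a = -a, because 1 = 0 in a brace. *)
move=> Ia; have := ideal_lambda idI a (idealV idI Ia).
by rewrite /brace_lambda mulgV brace_1E sub0r.
Qed.

Lemma ideal_sub (a b : B) : I a -> I b -> I (a - b).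
Proof. by move=> Ia Ib; apply: ideal_add => //; apply: ideal_opp. Qed.

End IdealTheory.

(** * Ideals of an asymmetric product *)

Section AsymIdeal.

Context (T S : zmodType) (D : asym_data T S) (I : asym_prod D -> Prop).
Context (idI : is_ideal I).

Lemma asym_ideal0 : I (AsymProd D 0 0).
Proof. exact: (ideal1 idI). Qed.

Lemma asym_ideal_snd (t : T) (c d : S) :
  I (AsymProd D t c) -> I (AsymProd D t (d + c)) -> I (AsymProd D 0 d).
Proof.
move=> Ic Id; have -> : AsymProd D 0 d = AsymProd D t (d + c) - AsymProd D t c.
  by apply/eqP; rewrite eq_sym subr_eq asym_prod_addE add0r asym_form0l addr0.
exact: ideal_sub.
Qed.

Lemma asym_ideal_form (t u : T) (c : S) :
  I (AsymProd D t c) -> I (AsymProd D 0 (asym_form D t u)).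
Proof.
move=> Itc; apply: (asym_ideal_snd Itc).
(* lambda_(-u,0)(t, c) = (t, b(t, u) + c). *)
have := ideal_lambda idI (AsymProd D (- u) 0) Itc.
congr I; apply/eqP; rewrite /brace_lambda subr_eq asym_prod_mulE asym_prod_addE.
rewrite asym_act0 add0r (asym_formC _ t (- u)) asym_formNl (asym_formC _ u).
by rewrite addr0 addrAC subrr add0r addrC.
Qed.

Lemma asym_ideal_act (u : T) (c : S) :
  I (AsymProd D 0 c) -> I (AsymProd D (u - asym_act D c u) 0).
Proof.
(* The conjugate of (0, c) by (u, 0) is (u - alpha_c(u), c). *)
move=> Ic; have Icu := idealJ idI (AsymProd D u 0) Ic.
have := ideal_sub idI Icu Ic; congr I.
rewrite -[(AsymProd D u 0)^-1%g]/(AsymProd _ _ _) /= !asym_prod_mulE.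
apply/eqP; rewrite subr_eq asym_prod_addE oppr0 asym_act0 asym_actN asym_actu0.
by rewrite !(addr0, add0r) asym_formC asym_form0l addr0.
Qed.

Lemma asym_ideal_sndD (c d : S) :
  I (AsymProd D 0 c) -> I (AsymProd D 0 d) -> I (AsymProd D 0 (c + d)).
Proof.
move=> Ic Id; have := ideal_add idI Ic Id.
by rewrite asym_prod_addE asym_form0l !addr0.
Qed.

End AsymIdeal.

(* A^(p^(n-1)) is a power of A^k and a root of 1 + y + ... + y^(p-1), which is *)
(* congruent to p modulo 1 - y; so 1 - A^k divides the unit p.                 *)
Lemma expmxB1_unit (R : comUnitRingType) d (A : 'M[R]_d) (p n k : nat) :
    prime p -> (0 < n)%N -> char_poly A = q_poly R p n ->
    (p%:R : R) \is a GRing.unit -> ~~ (p ^ n %| k)%N ->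
  1%:M - A ^+ k \in unitmx.
Proof.
case: d A => [|d] A pr_p n_gt0 charA unit_p ndvd.
  by rewrite unitmxE det_mx00 unitr1.
have AN : A ^+ (p ^ n) = 1.
  apply: (@expmx_char_dvd _ _ _ ('X^(p ^ n.-1) - 1)).
  by rewrite charA mul_q_poly.
have k_gt0 : (0 < k)%N by case: k ndvd; rewrite ?dvdn0.
have [j lt_jn gcdE] : exists2 j, (j < n)%N & gcdn k (p ^ n) = (p ^ j)%N.
  have /(dvdn_pfactor _ _ pr_p)[j le_jn gcdE] := dvdn_gcdr k (p ^ n).
  exists j => //; rewrite ltn_neqAle le_jn andbT; apply: contra ndvd => /eqP jn.
  by rewrite -jn -gcdE dvdn_gcdl.
have [a dvd_a] : exists a, A ^+ (p ^ n.-1) = (A ^+ k) ^+ a.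
  (* Bezout gives a k = b p^n + p^j; multiplying by p^(n-1-j) gives p^(n-1) modulo p^n, the exponent
     to be reached. *)
  have [a b bez _] := egcdnP (p ^ n) k_gt0.
  exists (a * p ^ (n.-1 - j))%N; rewrite -exprM mulnA (mulnC k) bez gcdE.
  rewrite mulnDl [(b * _)%N]mulnC -mulnA exprD exprM AN expr1n mul1r.
  by rewrite -expnD subnKC // -ltnS prednK.
have sum0 : \sum_(i < p) (A ^+ (p ^ n.-1)) ^+ i = 0.
  rewrite -[RHS](Cayley_Hamilton A) charA /q_poly rmorph_sum.
  by apply: eq_bigr => i _; rewrite /= rmorphXn /= horner_mx_X mulnC exprM.
have [Z defp] : exists Z, (1 - A ^+ k) * Z = p%:R.
  (* With y = A^(p^(n-1)), the first factor takes 1 - A^k to 1 - y, and the second takes 1 - y to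
     the sum of the 1 - y^i, which is p since the y^i sum to 0. *)
  exists ((\sum_(i < a) (A ^+ k) ^+ i) *
           \sum_(i < p) \sum_(l < i) (A ^+ (p ^ n.-1)) ^+ l).
  rewrite mulrA -[1 - _]opprB mulNr -subrX1 -dvd_a opprB mulr_sumr.
  under eq_bigr do rewrite -[1 - _]opprB mulNr -subrX1 opprB.
  by rewrite sumrB sum0 subr0 sumr_const card_ord.
apply: (proj1 (@mulmx1_unit _ _ _ ((p%:R)^-1 *: Z) _)).
rewrite -[LHS]/((1 - A ^+ k) * _) -scalerAr defp -scaler_nat scalerA.
by rewrite mulVr // scale1r.
Qed.

Section DffunSingle.

Context (I : finType) (V : I -> zmodType).

Definition dffun_single (i : I) (x : V i) : {dffun forall k, V k} :=
  [ffun k => dfwith (fun i => 0 : V i) x k].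

Lemma dffun_single_in i (x : V i) : dffun_single x i = x.
Proof. by rewrite ffunE dfwith_in. Qed.

Lemma dffun_single_out i (x : V i) k : i != k -> dffun_single x k = 0.
Proof. by move=> nik; rewrite ffunE dfwith_out. Qed.

End DffunSingle.

Lemma ord_pred_neq (m : nat) (i : 'I_m) : (1 < m)%N -> ord_pred i != i.
Proof.
case: i => i lt_im m_gt1; apply/eqP => /(congr1 (@ordS _)).
rewrite ord_predK => /(congr1 val) /= eq_i.
have [lt|] := ltnP i.+1 m; first by move: eq_i; rewrite modn_small // => /n_Sn.
move=> le; have eq_m : i.+1 = m by apply/eqP; rewrite eqn_leq lt_im.
by move: eq_i m_gt1; rewrite eq_m modnn -eq_m => ->.
Qed.

(** * The brace built from the cyclic data *)

Section Construction.

Context (m : nat) (p n s : 'I_m -> nat).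
Context (hp : forall i, prime (p i)) (hn : forall i, (0 < n i)%N).

Local Notation T := (T_prod p n s).
Local Notation S := (S_prod p n).

Definition S_single (i : 'I_m) (r : 'Z_(p i ^ n i)) : S :=
  dffun_single (V := fun k => 'Z_(p k ^ n k)) r.

Definition T_single (i : 'I_m) (j : 'I_(s i)) (w : T_ p n i) : T :=
  dffun_single (V := fun k => {ffun 'I_(s k) -> T_ p n k})
    [ffun j' => if j' == j then w else 0].

Lemma S_singleE i r : @S_single i r i = r.
Proof. exact: dffun_single_in. Qed.

Lemma S_single_out i r k : i != k -> @S_single i r k = 0.
Proof. exact: dffun_single_out. Qed.

Lemma T_singleE i j w :
  @T_single i j w i = [ffun j' => if j' == j then w else 0].
Proof. exact: dffun_single_in. Qed.

Lemma T_single_out i j w k : i != k -> @T_single i j w k = 0.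
Proof. exact: dffun_single_out. Qed.

Lemma modulus_gt1 i : (1 < p i ^ n i)%N.
Proof. by rewrite -(expn0 (p i)) ltn_exp2l // prime_gt1. Qed.

(** [J_mx] is symmetric and squares to 1, so these vectors are dual to the standard basis;
    nondegeneracy of b is used in this form. *)
Lemma b_dual i (t : T_ p n i) k :
  b_ t (delta_mx 0 k *m J_mx p n i) = t 0 k.
Proof.
rewrite /b_ trmx_mul trmx_delta mulmxA -(mulmxA t) /J_mx tr_block_mx.
rewrite mulmx_block !trmx0 !trmx1.
rewrite !(mulmx0, mul0mx, addr0, add0r, mulmx1) -scalar_mx_block mulmx1.
by rewrite -colE mxE.
Qed.

Lemma b_prod_single (t : T) i j k :
  b_prod t (T_single j (delta_mx 0 k *m J_mx p n i)) = S_single (t i j 0 k).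
Proof.
have b0 i' (x : T_ p n i') : b_ x 0 = 0 by rewrite /b_ trmx0 mulmx0 mxE.
apply/ffunP=> i'; rewrite ffunE; have [<-|ni] := eqVneq i i'; last first.
  rewrite big1 => [|l _]; first by rewrite S_single_out.
  by rewrite T_single_out // ffunE b0.
rewrite S_singleE T_singleE (bigD1 j) //= ffunE eqxx b_dual big1 ?addr0 //.
by move=> l /negPf nl; rewrite ffunE nl b0.
Qed.

Hypotheses (hm : (1 < m)%N) (hp_inj : injective p).

Lemma C_mxB1_unit i k : ~~ (p (ord_pred i) ^ n (ord_pred i) %| k)%N ->
  1%:M - C_mx p n i ^+ k \in unitmx.
Proof.
apply: expmxB1_unit => //; first by rewrite companionmxK ?q_poly_monic.
(* p_(i-1) is a unit of R_i: the primes are distinct, and i-1 differs from i as m > 1. *)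
rewrite unitZpE ?modulus_gt1 // coprime_sym coprime_pexpr // prime_coprime //.
rewrite dvdn_prime2 //; apply: contra (ord_pred_neq i hm) => /eqP/hp_inj ->.
exact: eqxx.
Qed.

Lemma F_mxB1_unit i k : ~~ (p (ord_pred i) ^ n (ord_pred i) %| k)%N ->
  1%:M - F_mx p n i ^+ k \in unitmx.
Proof.
move=> ndvd; have uC := C_mxB1_unit ndvd.
rewrite /F_mx expmx_block_diag scalar_mx_block opp_block_mx add_block_mx.
rewrite subrr unitmxE det_ublock unitrM; apply/andP; split; rewrite -unitmxE.
  by rewrite expmx_tr -trmx1 -linearB unitmx_tr.
have invCk := expmx_inv k (C_mx_unit hp hn i).
(* The lower block is 1 - C^(-k) = C^(-k) (C^k - 1), a product of units. *)
have : invmx (C_mx p n i) ^+ k *m (C_mx p n i ^+ k - 1%:M) \in unitmx.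
  rewrite unitmx_mul; case/mulmx1_unit: invCk => -> _ /=.
  by rewrite -opprB -scaleN1r unitmxZ ?unitrN ?unitr1.
by rewrite mulmxBr invCk mulmx1.
Qed.

Context (I : TS_brace s hp hn -> Prop) (idI : is_ideal I).

Local Notation D := (TS_data s hp hn).

(** Solve v - alpha_c(v) = u coordinate by coordinate; c only has to be nonzero just before the
    support of u. *)
Lemma ideal_fst (c : S) (u : T) :
    (forall i, u i != 0 -> c (ord_pred i) != 0) ->
  I (AsymProd D 0 c) -> I (AsymProd D u 0).
Proof.
move=> nzc Ic.
pose G i := 1%:M - F_mx p n i ^+ c (ord_pred i).
pose v : T := [ffun i => [ffun j => u i j *m invmx (G i)]].
have <- : v - alpha_prod c v = u.
  apply/ffunP=> i; rewrite !ffunE; apply/ffunP=> j; rewrite !ffunE iter_f_E.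
  rewrite -[X in X - _]mulmx1 -mulmxBr.
  (* Where u vanishes, [G i] may be singular, but v is 0 there whatever [invmx] returns. *)
  have [->|nzu] := eqVneq (u i) 0; first by rewrite ffunE !mul0mx.
  rewrite mulmxKV //; apply: F_mxB1_unit; apply: contra (nzc i nzu).
  move=> dvd; apply/eqP/val_inj => /=.
  have lt : (c (ord_pred i) < p (ord_pred i) ^ n (ord_pred i))%N.
    by rewrite -[X in (_ < X)%N]Zp_cast ?modulus_gt1.
  by apply/eqP; move: dvd; rewrite /dvdn modn_small.
exact: (asym_ideal_act idI v Ic).
Qed.

Hypothesis hs : forall i, (0 < s i)%N.

(** One step round the cycle: [ideal_fst] puts r times a basis vector of T_i in I, and pairing it
    with the dual vector leaves r. *)
Lemma ideal_single (c : S) i (r : 'Z_(p i ^ n i)) :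
    c (ord_pred i) != 0 -> I (AsymProd D 0 c) ->
  I (AsymProd D 0 (S_single r)).
Proof.
move=> nzc Ic.
have lt0l : (0 < l_prev p n i + l_prev p n i)%N.
  rewrite addn_gt0 orbb (l_prevE hp hn) subn_gt0 ltn_exp2l ?prime_gt1 //.
  by rewrite prednK.
pose k := Ordinal lt0l; pose j := Ordinal (hs i).
pose u := T_single j (r *: delta_mx 0 k : T_ p n i).
have Iu : I (AsymProd D u 0).
  apply: (ideal_fst _ Ic) => i'; have [<- //|ni] := eqVneq i i'.
  by rewrite /u T_single_out // eqxx.
have := asym_ideal_form idI (T_single j (delta_mx 0 k *m J_mx p n i)) Iu.
by rewrite /= b_prod_single T_singleE ffunE eqxx !mxE !eqxx mulr1.
Qed.

Lemma ideal_all_single (c : S) : c != 0 -> I (AsymProd D 0 c) ->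
  forall i (r : 'Z_(p i ^ n i)), I (AsymProd D 0 (S_single r)).
Proof.
move=> nzc Ic.
have [i0 nzi0] : exists i, c i != 0.
  apply/existsP; apply: contraR nzc => /existsPn c0.
  by apply/eqP/ffunP=> i; rewrite ffunE; apply/eqP; rewrite -[_ == _]negbK c0.
have step k : forall r : 'Z_(p (iter k.+1 (@ordS m) i0) ^ n (iter k.+1 (@ordS m) i0)),
    I (AsymProd D 0 (S_single r)).
  elim: k => [|k IHk] r; first by apply: (ideal_single _ _ Ic); rewrite /= ordSK.
  (* The unit vector at one index serves as the nonzero element for the next. *)
  apply: (ideal_single _ _ (IHk 1)).
  by rewrite iterS ordSK S_singleE oner_neq0.
move=> i.
(* At least one step is always taken, so [i0] itself is reached after a full turn of m steps. *)
have <- // : iter (i + (m - i0.+1)).+1 (@ordS m) i0 = i.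
have iterE k : iter k (@ordS m) i0 = ((i0 + k) %% m)%N :> nat.
  elim: k => [|k IHk]; first by rewrite addn0 modn_small.
  by rewrite iterS /= IHk addnS -addn1 modnDml addn1.
apply: ord_inj; rewrite iterE addnS -addSn addnCA subnKC //.
by rewrite modnDr modn_small.
Qed.

Lemma ideal_full (c : S) : c != 0 -> I (AsymProd D 0 c) -> forall x, I x.
Proof.
move=> nzc Ic; have Isingle := ideal_all_single nzc Ic.
have IS d : I (AsymProd D 0 d).
  have -> : d = \sum_i S_single (d i).
    apply/ffunP=> k.
    have -> (e : 'I_m -> S) : (\sum_i e i) k = \sum_i e i k.
      by elim/big_rec2: _ => [|i y1 y2 _ <-]; rewrite ffunE.
    rewrite (bigD1 k) //= S_singleE big1 ?addr0 // => i nik.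
    by rewrite S_single_out.
  elim/big_rec: _ => [|i d' _ Id']; first exact: asym_ideal0.
  exact: asym_ideal_sndD.
case=> t d; have It : I (AsymProd D t 0).
  (* The all-ones element is nonzero at every index, so every t is reached at once. *)
  by apply: (ideal_fst _ (IS [ffun=> 1])) => i _; rewrite ffunE oner_neq0.
have := ideal_add idI It (IS d); congr I.
by rewrite asym_prod_addE asym_formC asym_form0l !(addr0, add0r).
Qed.

End Construction.

Local Close Scope ring_scope.

Theorem proposition3p3 (m : nat) (p n s : 'I_m -> nat)
    (hm : 1 < m)
    (hp : forall i : 'I_m, prime (p i))
    (hp_inj : injective p)
    (hn : forall i : 'I_m, 0 < n i)
    (hs : forall i : 'I_m, 0 < s i) :
  simple_brace (TS_brace s hp hn).
Proof.
split.
  pose i0 := Ordinal (ltnW hm).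
  pose c := S_single (n := n) (1%R : 'Z_(p i0 ^ n i0)).
  exists (AsymProd (TS_data s hp hn) 0%R c).
  move=> eq0; have /ffunP/(_ i0)/eqP : c = 0%R := congr1 (@asym_snd _ _ _) eq0.
  by rewrite S_singleE ffunE oner_eq0.
move=> I idI.
have [full | nfull] := classic (forall x, I x); first by right.
left=> x; split=> [Ix | ->]; last exact: (asym_ideal0 idI).
case: x Ix => t c Itc.
(* A proper ideal meets 0 x S trivially; pairing t with the dual vectors then kills each of its
   coordinates. *)
have Ic0 d : I (AsymProd _ 0%R d) -> d = 0%R.
  move=> Id; apply/eqP; apply/negPn/negP => nzd.
  by case: nfull; apply: (ideal_full hm hp_inj idI hs nzd Id).
have t0 : t = 0%R.
  apply/ffunP=> i; rewrite ffunE; apply/ffunP=> j; rewrite ffunE.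
  apply/rowP=> k; rewrite mxE.
  have := Ic0 _ (asym_ideal_form idI
    (T_single j (delta_mx 0%R k *m J_mx p n i)%R) Itc).
  by rewrite /= b_prod_single => /ffunP/(_ i); rewrite S_singleE ffunE.
by move: Itc; rewrite t0 => /Ic0 ->.
Qed.
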